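(* Let $\Lambda\subset\mathbb{R}^N$ be an $(r,R)$-Delone set. For $x\in\Lambda$ let $V_x=\{p\in\mathbb{R}^N:\|p-x\|\le\|p-y\|\text{ for all }y\in\Lambda, y\ne x\}$ be its Voronoi cell. Then both $$\mathcal{N}_V(\Lambda):=\{(x,y)\in\Lambda\times\Lambda: V_x\text{ and }V_y\text{ share a non-trivial part of an }(N-1)\text{-face}\}$$ and $$\mathcal{N}_{max}(\Lambda):=\{(x,y)\in\Lambda\times\Lambda:\|x-y\|\le 2R\}$$ are neighbor relations on $\Lambda$.
   Context: Euclidean setting: $\|\cdot\|$ is the Euclidean norm on $\mathbb{R}^N$, $B_S$ is the closed ball of radius $S$ around the origin, $[x,y]=\{x+t(y-x):t\in[0,1]\}$. $(r,R)$-Delone set: a subset $\Lambda\subset\mathbb{R}^N$ with $r,R>0$ such that $\|x-y\|\ge 2r$ for all distinct $x,y\in\Lambda$ and $\mathbb{R}^N=\bigcup_{x\in\Lambda}(x+B_R)$. Neighbor relation: a neighbor relation on a Delone set $\Lambda$ is a subset $\mathcal{N}\subset\Lambda\times\Lambda$ such that for some $S>0$: (N0) $\mathcal{N}$ is symmetric and contains the diagonal $\{(x,x):x\in\Lambda\}$; (N1) $\|x-y\|\le S$ for all $(x,y)\in\mathcal{N}$; (N2) for all $x,y\in\Lambda$ there is a finite sequence $(x_0,\dots,x_n)$ in $\Lambda$ with $x_0=x$, $x_n=y$, $(x_i,x_{i+1})\in\mathcal{N}$ for $i=0,\dots,n-1$, and $\{x_0,\dots,x_n\}\subset[x,y]+B_S$.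 The Voronoi cells $V_x$ of a Delone set are convex polytopes. ''$V_x$ and $V_y$ share a non-trivial part of an $(N-1)$-face'' means that there are $(N-1)$-dimensional faces $F$ of $V_x$ and $F'$ of $V_y$ such that $F\cap F'$ has positive $(N-1)$-dimensional (Hausdorff) measure; in particular this holds for $x=y$. *)

(* Defs.v *)
From HB Require Import structures.
From mathcomp Require Import all_boot all_order all_algebra.
From mathcomp Require Import all_classical all_reals all_analysis.

Set Implicit Arguments.
Unset Strict Implicit.
Unset Printing Implicit Defensive.

Import Order.TTheory GRing.Theory Num.Theory.

Local Open Scope classical_set_scope.
Local Open Scope ring_scope.

Section Euclidean.
Context {R : realType} {N : nat}.
Implicit Types (x y p c : 'rV[R]_N) (A B P F : set 'rV[R]_N).

Definition dotp x y : R := \sum_(i < N) x 0 i * y 0 i.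

(* The library norm on 'rV[R]_N is the sup norm. *)
Definition enorm x : R := Num.sqrt (dotp x x).

Definition cball (S : R) : set 'rV[R]_N := [set p | enorm p <= S].

Definition segment x y : set 'rV[R]_N :=
  [set x + t *: (y - x) | t in [set t : R | 0 <= t <= 1]].

Definition setsum A B : set 'rV[R]_N := [set a + b | a in A & b in B].

(* diam set0 = -oo. *)
Definition diam A : \bar R :=
  ereal_sup [set (enorm (x - y))%:E | x in A & y in A].

(* The empty set weighs 0 in every dimension, while a point weighs 1 in
   dimension 0 since 0 `^ 0 = 1. *)
Definition hausdorff_gauge (s : R) A : \bar R :=
  if A == set0 then 0%E else poweR (diam A) s.

Definition hausdorff_pre (s delta : R) A : \bar R :=
  ereal_inf [set (\sum_(i <oo) hausdorff_gauge s (U i))%E |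
    U in [set U : (set 'rV[R]_N)^nat |
            A `<=` \bigcup_i U i /\ forall i, (diam (U i) <= delta%:E)%E]].

(* s-dimensional Hausdorff (outer) measure for the Euclidean metric, without
   normalizing constant. *)
Definition hausdorff (s : R) A : \bar R :=
  ereal_sup [set hausdorff_pre s delta A | delta in [set delta : R | 0 < delta]].

Definition affine_hull A : set 'rV[R]_N :=
  [set p | exists n (a : 'I_n -> R) (v : 'I_n -> 'rV[R]_N),
     [/\ forall i, A (v i), \sum_(i < n) a i = 1
       & p = \sum_(i < n) a i *: v i]].

Definition has_affine_dim A (d : nat) : Prop :=
  exists (p : 'rV[R]_N) (U : {vspace 'rV[R]_N}),
    \dim U = d /\ affine_hull A = [set p + u | u in [set u | u \in U]].

(* Faces are cut out by valid inequalities; c = 0 gives the improper faces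
   P and set0. *)
Definition is_face P F : Prop :=
  exists (c : 'rV[R]_N) (b : R),
    (forall p, P p -> dotp c p <= b) /\ F = P `&` [set p | dotp c p = b].

Definition is_face_of_dim (d : nat) P F : Prop :=
  is_face P F /\ has_affine_dim F d.

End Euclidean.

Section Delone.
Context {R : realType} {N : nat}.
Implicit Types (L : set 'rV[R]_N) (E : set ('rV[R]_N * 'rV[R]_N)).

Definition is_delone (rmin Rmax : R) L : Prop :=
  [/\ 0 < rmin, 0 < Rmax,
      forall x y, L x -> L y -> x != y -> 2 * rmin <= enorm (x - y)
    & \bigcup_(x in L) [set x + v | v in cball Rmax] = setT].

Definition is_neighbor_relation L E : Prop :=
  E `<=` L `*` L /\
  exists S : R,
    [/\ 0 < S,
        (forall x y, E (x, y) -> E (y, x)) /\ (forall x, L x -> E (x, x)),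
        forall x y, E (x, y) -> enorm (x - y) <= S
      & forall x y, L x -> L y ->
          exists (n : nat) (z : nat -> 'rV[R]_N),
            [/\ z 0%N = x, z n = y,
                forall i, (i <= n)%N -> L (z i),
                forall i, (i < n)%N -> E (z i, z i.+1)
              & forall i, (i <= n)%N ->
                  setsum (segment x y) (cball S) (z i)]].

Definition voronoi_cell L (x : 'rV[R]_N) : set 'rV[R]_N :=
  [set p | forall y, L y -> y != x -> enorm (p - x) <= enorm (p - y)].

(* Only meaningful for N > 0, because of the truncated predecessor. *)
Definition share_facet_part (P Q : set 'rV[R]_N) : Prop :=
  exists F F', [/\ is_face_of_dim N.-1 P F, is_face_of_dim N.-1 Q F'
                 & (0 < hausdorff (N.-1)%:R (F `&` F'))%E].

Definition voronoi_neighbors L : set ('rV[R]_N * 'rV[R]_N) :=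
  [set xy | [/\ L xy.1, L xy.2
              & share_facet_part (voronoi_cell L xy.1) (voronoi_cell L xy.2)]].

Definition max_neighbors (Rmax : R) L : set ('rV[R]_N * 'rV[R]_N) :=
  [set xy | [/\ L xy.1, L xy.2 & enorm (xy.1 - xy.2) <= 2 * Rmax]].

End Delone.

(* Main.v *)
From HB Require Import structures.
Require Import Defs.
From mathcomp Require Import all_boot all_order all_algebra.
From mathcomp Require Import all_classical all_reals all_analysis.
From mathcomp Require Import measurable_realfun.
From mathcomp Require Import ring lra.
Import Order.TTheory GRing.Theory Num.Theory.
Import numFieldNormedType.Exports.
Set Implicit Arguments.
Unset Strict Implicit.
Unset Printing Implicit Defensive.
Local Open Scope classical_set_scope.
Local Open Scope ring_scope.

(** Only one fact carries the theorem: any two points [x], [y] of the Delone set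
    are joined by a chain of points near the segment [[x,y]] in which the Voronoi
    cells of consecutive points share part of a facet.  Everything else follows
    from it.  A common point of two cells is within [Rmax] of both centers
    ([voronoi_cell_radius]), so Voronoi neighbors are at distance at most
    [2 * Rmax], and the chain serves both relations ([neighbor_path]).  A chain
    from [x] to any other point leaves [x] through a facet of its cell, which
    gives the diagonal of the Voronoi relation ([share_facet_part_refl]).

    For the chain, replace [y] by a point [y'] within [rmin] of [y], hence still
    in the cell of [y], such that no point of the segment from [x] to [y'] is
    equidistant from three points of the set ([generic_endpoint]).  This excludes
    only finitely many hyperplanes of positions of [y'], one for each triple of
    points near the segment ([equidistant_hyperplane], [avoid_hyperplanes]).  The
    times at which the segment is in a given cell form a closed set; finitely many
    of these sets cover [[0,1]], which is connected, so two cells visited by the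
    segment are joined by a chain of cells that consecutively meet on the segment
    ([closed_cover_chain]).  At such a meeting point [p] of the cells of [z] and
    [w] every other point of the set is strictly farther, so a whole
    [(N-1)]-dimensional disk of the bisector of [z] and [w] around [p] lies in
    both cells ([voronoi_share_facet]).  The intersection of each cell with the
    bisector is then a face, its affine hull is the bisector, and both faces
    contain the disk.

    It remains that a disk of codimension one has positive Hausdorff measure
    ([hausdorff_codim1_disk_gt0]).  Projecting along one coordinate turns a cover
    of the disk into a cover of a cube by boxes, and boxes covering the unit cube
    have total volume at least one ([box_cover_sum_ge1], by slicing). *)

(** * Euclidean norm *)

Section EuclideanGeometry.
Context {R : realType} {N : nat}.
Implicit Types (x y z p q c : 'rV[R]_N) (a t : R).

Lemma dotpC x y : dotp x y = dotp y x.
Proof. by apply: eq_bigr => i _; rewrite mulrC. Qed.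

Lemma dotpDl x y z : dotp (x + y) z = dotp x z + dotp y z.
Proof. by rewrite -big_split; apply: eq_bigr => i _; rewrite mxE mulrDl. Qed.

Lemma dotpZl a x y : dotp (a *: x) y = a * dotp x y.
Proof. by rewrite /dotp mulr_sumr; apply: eq_bigr => i _; rewrite mxE mulrA. Qed.

Lemma dotpNl x y : dotp (- x) y = - dotp x y.
Proof. by rewrite -scaleN1r dotpZl mulN1r. Qed.

Lemma dotpDr x y z : dotp z (x + y) = dotp z x + dotp z y.
Proof. by rewrite dotpC dotpDl !(dotpC z). Qed.

Lemma dotpZr a x y : dotp x (a *: y) = a * dotp x y.
Proof. by rewrite dotpC dotpZl dotpC. Qed.

Lemma dotpNr x y : dotp x (- y) = - dotp x y.
Proof. by rewrite dotpC dotpNl dotpC. Qed.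

(** Expands inner products of linear combinations into inner products of the
    vectors, which leaves goals to the ring and linear arithmetic tactics. *)
Definition dotpE := (dotpDl, dotpDr, dotpNl, dotpNr, dotpZl, dotpZr).

Lemma dotp_sumr c (I : Type) (s : seq I) (f : I -> 'rV[R]_N) :
  dotp c (\sum_(i <- s) f i) = \sum_(i <- s) dotp c (f i).
Proof.
elim/big_ind2 : _ => [|u1 v1 u2 v2 <- <-|//]; last by rewrite dotpDr.
by rewrite /dotp big1 // => i _; rewrite mxE mulr0.
Qed.

Lemma dotp_ge0 x : 0 <= dotp x x.
Proof. by apply: sumr_ge0 => i _; rewrite -expr2 sqr_ge0. Qed.

Lemma dotp_eq0 x : (dotp x x == 0) = (x == 0).
Proof.
apply/eqP/eqP => [h|->]; last by rewrite /dotp big1 // => i _; rewrite mxE mul0r.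
apply/rowP => i; rewrite mxE; apply/eqP.
rewrite -sqrf_eq0 expr2; apply/eqP.
by apply: (psumr_eq0P _ h) => // j _; rewrite -expr2 sqr_ge0.
Qed.

Lemma dotp_gt0 x : (0 < dotp x x) = (x != 0).
Proof. by rewrite lt_def dotp_eq0 dotp_ge0 andbT. Qed.

Lemma enorm_ge0 x : 0 <= enorm x. Proof. exact: sqrtr_ge0. Qed.

Lemma sqr_enorm x : enorm x ^+ 2 = dotp x x.
Proof. by rewrite sqr_sqrtr // dotp_ge0. Qed.

Lemma ler_enorm x y : (enorm x <= enorm y) = (dotp x x <= dotp y y).
Proof. by rewrite ler_sqrt // dotp_ge0. Qed.

Lemma enorm_le a x : 0 <= a -> (enorm x <= a) = (dotp x x <= a ^+ 2).
Proof.
move=> a0; rewrite -sqr_enorm ler_pXn2r // nnegrE //; exact: enorm_ge0.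
Qed.

Lemma enorm0 : enorm (0 : 'rV[R]_N) = 0.
Proof. by rewrite /enorm (eqP (_ : dotp 0 0 == 0)) ?sqrtr0 // dotp_eq0. Qed.

Lemma enorm_eq0 x : enorm x = 0 -> x = 0.
Proof. by move=> h; apply/eqP; rewrite -dotp_eq0 -sqr_enorm h expr2 mul0r. Qed.

Lemma enormN x : enorm (- x) = enorm x.
Proof. by rewrite /enorm !dotpE opprK. Qed.

Lemma edistC x y : enorm (x - y) = enorm (y - x).
Proof. by rewrite -enormN opprB. Qed.

Lemma enormZ a x : enorm (a *: x) = `|a| * enorm x.
Proof.
by rewrite /enorm !dotpE mulrA -expr2 sqrtrM ?sqr_ge0 // sqrtr_sqr.
Qed.

Lemma cauchy_schwarz x y : dotp x y <= enorm x * enorm y.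
Proof.
have [->|y0] := eqVneq y 0.
  rewrite enorm0 mulr0 -(scale0r 0) dotpZr mul0r //.
have yy : 0 < dotp y y by rewrite dotp_gt0.
have h : dotp x y ^+ 2 <= dotp x x * dotp y y.
  have := dotp_ge0 (dotp y y *: x - dotp x y *: y).
  rewrite !dotpE (dotpC y x) => h.
  rewrite -(ler_pM2l yy) -subr_ge0.
  by apply: le_trans h _; rewrite le_eqVlt; apply/orP; left; apply/eqP; ring.
apply: le_trans (ler_norm _) _.
rewrite -(@ler_pXn2r _ 2) // ?nnegrE ?mulr_ge0 ?enorm_ge0 //.
by rewrite real_normK ?num_real // exprMn !sqr_enorm.
Qed.

Lemma enormD x y : enorm (x + y) <= enorm x + enorm y.
Proof.
rewrite enorm_le ?addr_ge0 ?enorm_ge0 // sqrrD !sqr_enorm !dotpE (dotpC y x).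
have := cauchy_schwarz x y; lra.
Qed.

Lemma edist_triangle y x z : enorm (x - z) <= enorm (x - y) + enorm (y - z).
Proof. by apply: le_trans (enormD _ _); rewrite addrA subrK. Qed.

Lemma coord_le_enorm x i : `|x 0 i| <= enorm x.
Proof.
rewrite -sqrtr_sqr ler_sqrt ?dotp_ge0 // /dotp (bigD1 i) //= expr2 lerDl.
by apply: sumr_ge0 => j _; rewrite -expr2 sqr_ge0.
Qed.

Lemma enorm_le_coord a x : 0 <= a -> (forall i, `|x 0 i| <= a) ->
  enorm x <= N%:R * a.
Proof.
move=> a0 h; rewrite enorm_le ?mulr_ge0 //.
apply: (@le_trans _ _ (\sum_(i < N) a ^+ 2)).
  apply: ler_sum => i _; rewrite -expr2 -real_normK ?num_real //.
  by rewrite ler_pXn2r ?nnegrE.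
rewrite sumr_const card_ord -[leLHS]mulr_natl exprMn.
apply: ler_wpM2r; first exact: sqr_ge0.
by rewrite -natrX ler_nat; case: (N) => // n; rewrite expnS expn1 leq_pmulr.
Qed.

End EuclideanGeometry.

(** * Hausdorff measure of disks in hyperplanes *)

(** At height [t] in the last direction, the boxes that reach this height cover a
    cube of one dimension less, so the [d]-th powers of their sides add up to at
    least one.  Integrating over [t] and exchanging the sum with the integral
    multiplies each term by the length of the range of heights of its box.  The
    selection [D] keeps track of the boxes that reach the current slice, and
    points are functions on [nat] so that slicing does not change their type. *)
Lemma box_cover_sum_ge1 (R : realType) (d : nat) (D : nat -> bool)
    (a : nat -> nat -> R) (s : nat -> R) :
  (forall i, 0 <= s i) ->
  (forall u : nat -> R, (forall j, (j < d)%N -> 0 <= u j <= 1) ->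
     exists i, D i /\ forall j, (j < d)%N -> a i j <= u j <= a i j + s i) ->
  (1 <= \sum_(i <oo | D i) (s i ^+ d)%:E)%E.
Proof.
move=> s0; elim: d D => [|d IH] D cov.
  have [//|i [Di _]] := cov (fun=> 0).
  have h0 n : (0 <= n)%N -> D n -> (0 <= (s n ^+ 0)%:E)%E.
    by rewrite expr0 lee_fin.
  apply: le_trans (nneseries_lim_ge i.+1 h0).
  by rewrite big_mkcond big_nat_recr //= Di expr0 leeDr // sume_ge0 // => j _;
    case: ifP.
pose J i := `[a i d, a i d + s i]%classic : set (measurableTypeR R).
pose f i (t : measurableTypeR R) : \bar R := ((D i)%:R * s i ^+ d * \1_(J i) t)%:E.
have w0 i : 0 <= (D i)%:R * s i ^+ d by rewrite mulr_ge0 ?ler0n ?exprn_ge0.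
have f0 i t : (0 <= f i t)%E by rewrite lee_fin mulr_ge0.
have mJ i : measurable (J i) by exact: measurable_itv.
have mI : measurable (`[0, 1]%classic : set (measurableTypeR R)).
  exact: measurable_itv.
have mf i : measurable_fun (`[0, 1]%classic : set (measurableTypeR R)) (f i).
  apply/measurable_EFinP; apply: measurable_funM; first exact: measurable_cst.
  exact: measurable_indic.
have slice (t : R) : `[0, 1]%classic t -> (1 <= \sum_(i <oo) f i t)%E.
  rewrite /= in_itv /= => t01.
  rewrite (_ : (\sum_(i <oo) f i t)%E =
      (\sum_(i <oo | D i && (t \in J i)) (s i ^+ d)%:E)%E).
    apply: IH => u u01.
    have [j|i [Di Hi]] := cov (fun j => if j == d then t else u j).
      case: eqP => // /eqP jd; rewrite ltnS leq_eqVlt (negPf jd) /=; exact: u01.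
    exists i; rewrite Di /=; split.
      by rewrite inE /J /= in_itv /=; have := Hi d (ltnSn d); rewrite eqxx.
    by move=> j jd; have := Hi j (ltnW jd); rewrite ltn_eqF.
  rewrite [RHS]eseries_mkcond; apply: eq_eseriesr => i _.
  rewrite /f indicE; case: (D i); case: (t \in J i) => /=;
    by rewrite ?(mul1r, mul0r, mulr0, mulr1).
have -> : 1%E = (\int[lebesgue_measure]_(x in `[0%R, 1%R]%classic) (1 : R)%:E)%E.
  by rewrite integral_cst //= lebesgue_measure_itv /= lte_fin ltr01 sube0 mul1e.
apply: (@le_trans _ _
   (\int[lebesgue_measure]_(x in `[0%R, 1%R]%classic) (\sum_(i <oo) f i x))%E).
  apply: ge0_le_integral => //.
  exact: (@ge0_emeasurable_sum _ _ _ _ f xpredT).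
rewrite integral_nneseries //.
rewrite [leRHS]eseries_mkcond; apply: lee_nneseries => [i _ _|i _].
  exact: integral_ge0.
rewrite /f; under eq_integral do rewrite EFinM.
rewrite ge0_integralZl_EFin //; last first.
  by apply/measurable_EFinP; exact: measurable_indic.
rewrite integral_indic //.
apply: (@le_trans _ _ (((D i)%:R * s i ^+ d)%:E * lebesgue_measure (J i))%E).
  rewrite lee_wpmul2l ?lee_fin // le_measure ?inE //.
  exact: measurableI.
rewrite lebesgue_measure_itv /= lte_fin.
case: (D i) => /=; last by rewrite mul0r mul0e.
rewrite mul1r; case: ifP => _; last by rewrite mule0 lee_fin exprn_ge0.
by rewrite -EFinD -EFinM lee_fin addrAC subrr add0r -exprSr.
Qed.

Section Hausdorff.
Context {R : realType}.

Lemma le_diam (N : nat) (A : set 'rV[R]_N) x y : A x -> A y ->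
  ((enorm (x - y))%:E <= diam A)%E.
Proof. by move=> Ax Ay; apply: ereal_sup_ubound; exists x => //; exists y. Qed.

Lemma diam_ge0 (N : nat) (A : set 'rV[R]_N) : A !=set0 -> (0 <= diam A)%E.
Proof. by case=> x Ax; have := le_diam Ax Ax; rewrite subrr enorm0. Qed.

Lemma hausdorff_gauge_nat (N d : nat) (A : set 'rV[R]_N) : A !=set0 ->
  diam A \is a fin_num ->
  hausdorff_gauge d%:R A = (fine (diam A) ^+ d)%:E.
Proof.
move=> A0 fA; rewrite /hausdorff_gauge; case: eqP => [/eqP A00|_].
  by move/set0P: A0; rewrite A00.
rewrite -{1}(fineK fA) poweR_EFin powR_mulrn //.
by apply: fine_ge0; exact: diam_ge0.
Qed.

Lemma hausdorff_set0 (N : nat) (s : R) :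
  (hausdorff s (set0 : set 'rV[R]_N) <= 0)%E.
Proof.
apply: ge_ereal_sup => _ [delta _ <-].
apply: ereal_inf_lbound; exists (fun=> set0); last first.
  by apply: eseries0 => i _ _; rewrite /hausdorff_gauge eqxx.
split=> // i; rewrite /diam.
rewrite (_ : [set _ | _ in _ & _ in _] = set0) ?ereal_sup0 ?leNye //.
by apply/seteqP; split => // z [].
Qed.

Lemma le_hausdorff (N : nat) (s : R) (A B : set 'rV[R]_N) :
  A `<=` B -> (hausdorff s A <= hausdorff s B)%E.
Proof.
move=> AB; apply: ge_ereal_sup => _ [delta d0 <-].
apply: (@le_trans _ _ (hausdorff_pre s delta B)); last first.
  by apply: ereal_sup_ubound; exists delta.
apply: ereal_inf_le_tmp => _ [U [BU dU] <-]; exists U => //; split=> //.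
exact: subset_trans AB BU.
Qed.

(** The hyperplane through the origin with normal vector [c], written as a graph
    over the coordinates other than [k]. *)
Definition graph_lift (d : nat) (c : 'rV[R]_d.+1) (k : 'I_d.+1) (u : nat -> R) :
    'rV[R]_d.+1 :=
  \row_i if unlift k i is Some j then u j
         else - (\sum_(j < d) c 0 (lift k j) * u j) / c 0 k.

Lemma graph_lift_coord d (c : 'rV[R]_d.+1) k u (j : 'I_d) :
  graph_lift c k u 0 (lift k j) = u j.
Proof. by rewrite mxE liftK. Qed.

Lemma dotp_graph_lift d (c : 'rV[R]_d.+1) k u : c 0 k != 0 ->
  dotp c (graph_lift c k u) = 0.
Proof.
move=> ck; rewrite /dotp (bigD1_ord k) //= mxE unlift_none mulrCA divff // mulr1.
by under [X in _ + X]eq_bigr do rewrite graph_lift_coord; rewrite addNr.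
Qed.

Lemma graph_lift_bounded d (c : 'rV[R]_d.+1) k : exists2 M, 0 < M &
  forall u : nat -> R, (forall j, (j < d)%N -> 0 <= u j <= 1) ->
    enorm (graph_lift c k u) <= M.
Proof.
pose B := 1 + (\sum_(j < d) `|c 0 (lift k j)|) / `|c 0 k|.
have B1 : 1 <= B by rewrite lerDl divr_ge0 // sumr_ge0.
exists (d.+1%:R * B); first by rewrite mulr_gt0 // (lt_le_trans _ B1).
move=> u u01; apply: enorm_le_coord; first exact: le_trans B1.
move=> i; rewrite mxE; case: unliftP => [j _|_].
  have /andP[u0 u1] := u01 j (ltn_ord j).
  by rewrite ger0_norm // (le_trans u1).
rewrite normrM normrN normfV.
apply: (@le_trans _ _ ((\sum_(j < d) `|c 0 (lift k j)|) / `|c 0 k|)); last first.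
  by rewrite lerDr.
apply: ler_wpM2r; first by rewrite invr_ge0.
apply: le_trans (ler_norm_sum _ _ _) _; apply: ler_sum => j _.
have /andP[u0 u1] := u01 j (ltn_ord j).
by rewrite normrM (ger0_norm u0) ler_piMr.
Qed.

(** Coordinates do not increase distances.  Hence, if sets of diameters [s i]
    cover the disk, then boxes of sides [2 * s i], centered at the projections of
    chosen points of these sets, cover a cube of side [h] over which the
    hyperplane stays in the disk, and [(h / 2) ^+ d] bounds the sum of the
    [s i ^+ d] from below, for every cover. *)
Lemma hausdorff_hyperplane_disk_gt0 (d : nat) (A : set 'rV[R]_d.+1)
    (p c : 'rV[R]_d.+1) (e : R) :
  c != 0 -> 0 < e ->
  (forall q, enorm (q - p) <= e -> dotp c q = dotp c p -> A q) ->
  (0 < hausdorff d%:R A)%E.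
Proof.
move=> c0 e0 diskA.
have [k ck] : exists k, c 0 k != 0.
  apply/existsP; apply: contraNT c0 => /existsPn h.
  by apply/eqP/rowP => i; rewrite mxE; apply/eqP; rewrite -[_ == _]negbK h.
have [M M0 HM] := graph_lift_bounded c k.
pose h := e / M; have h0 : 0 < h by rewrite divr_gt0.
have hN0 : h != 0 by rewrite gt_eqF.
suff H : (((2 / h) ^+ d)^-1%:E <= hausdorff_pre d%:R 1 A)%E.
  apply: (@lt_le_trans _ _ ((2 / h) ^+ d)^-1%:E).
    by rewrite lte_fin invr_gt0 exprn_gt0 // divr_gt0.
  by apply: le_trans H _; apply: ereal_sup_ubound; exists 1 => //=.
apply: le_ereal_inf_tmp => _ [U [covU diamU] <-].
pose D i := U i != set0.
have fU i : D i -> diam (U i) \is a fin_num.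
  move=> /set0P Di; rewrite ge0_fin_numE ?diam_ge0 //.
  by apply: le_lt_trans (diamU i) _; rewrite ltry.
pose s i := if D i then fine (diam (U i)) else 0.
have s0 i : 0 <= s i.
  rewrite /s; case: ifP => // /set0P Di; exact/fine_ge0/diam_ge0.
have gaugeE i : hausdorff_gauge d%:R (U i) =
    if D i then (s i ^+ d)%:E else 0%E.
  rewrite /s; case: ifP => Di; last first.
    by rewrite /hausdorff_gauge; move: Di; rewrite /D; case: eqP.
  by have /set0P U0 := Di; rewrite Di hausdorff_gauge_nat // fU.
under eq_eseriesr do rewrite gaugeE.
rewrite -eseries_mkcond.
rewrite -[leLHS]mule1 lee_pdivrMl; last by rewrite exprn_gt0 // divr_gt0.
rewrite -nneseriesZl; last by move=> i _; rewrite lee_fin exprn_ge0.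
under eq_eseriesr do rewrite -EFinM -exprMn.
(* coordinates are taken relative to p and divided by h: the cube becomes the
   unit cube, and the boxes get sides 2 s_i / h *)
pose v i := xget p (U i).
pose g (q : 'rV[R]_d.+1) (j : nat) : R :=
  if (insub j : option 'I_d) is Some j' then (q - p) 0 (lift k j') / h else 0.
apply: (@box_cover_sum_ge1 _ d D (fun i j => g (v i) j - s i / h)
          (fun i => 2 / h * s i)).
  by move=> i; rewrite mulr_ge0 // divr_ge0 // ltW.
move=> u u01; pose q := p + h *: graph_lift c k u.
have [i _ Uq] : (\bigcup_i U i) q.
  apply: covU; apply: diskA; last first.
    by rewrite /q !dotpE dotp_graph_lift // mulr0 addr0.
  rewrite /q addrAC subrr add0r enormZ gtr0_norm //.
  by rewrite /h mulrAC ler_pdivrMr // ler_pM2l // HM.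
exists i; have Di : D i by apply/set0P; exists q.
split=> // j jd.
have Uv : U i (v i) by apply: xgetPex; exists q.
have : `|(q - v i) 0 (lift k (Ordinal jd))| <= s i.
  apply: le_trans (coord_le_enorm _ _) _.
  by rewrite /s Di -lee_fin fineK ?fU //; exact: le_diam.
rewrite /g insubT; set j' := lift _ _.
have -> : (q - v i) 0 j' = h * u j - (v i - p) 0 j'.
  by rewrite /q !mxE liftK /=; ring.
rewrite ler_norml => /andP[h1 h2]; apply/andP; split.
  by rewrite -(ler_pM2l h0) mulrBr ![h * (_ / h)]mulrC !divfK //; lra.
by rewrite -(ler_pM2l h0) mulrDr mulrBr ![h * (_ / h)]mulrC !divfK //
  [h * (2 / h * _)]mulrA [h * (2 / h)]mulrC divfK //; lra.
Qed.

(** The codimension one case in the form needed for facets: a nonzero normal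
    vector excludes dimension zero, so the truncated predecessor is harmless. *)
Lemma hausdorff_codim1_disk_gt0 (N : nat) (A : set 'rV[R]_N)
    (p c : 'rV[R]_N) (e : R) :
  c != 0 -> 0 < e ->
  (forall q, enorm (q - p) <= e -> dotp c q = dotp c p -> A q) ->
  (0 < hausdorff (N.-1)%:R A)%E.
Proof.
case: N A p c => [|d] A p c; last exact: hausdorff_hyperplane_disk_gt0.
by rewrite thinmx0 eqxx.
Qed.

End Hausdorff.

(** * Faces cut out by bisectors *)

Section HyperplaneDisk.
Context {R : realType} {N : nat}.
Implicit Types (p q c x y : 'rV[R]_N) (F : set 'rV[R]_N).

Lemma dim_orthogonal c : c != 0 ->
  exists U : {vspace 'rV[R]_N},
    \dim U = N.-1 /\ forall u, (u \in U) = (dotp c u == 0).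
Proof.
move=> c0.
have lin : linear (dotp c : 'rV[R]_N -> R^o).
  by move=> a u v; rewrite !dotpE.
pose g : {linear 'rV[R]_N -> R^o} :=
  HB.pack (dotp c : 'rV[R]_N -> R^o) (GRing.isLinear.Build _ _ _ _ _ lin).
pose f := linfun g.
exists (lker f); split; last first.
  by move=> u; rewrite memv_ker lfunE.
have : (\dim (lker f) + \dim (limg f) = N)%N.
  by have := limg_ker_dim f fullv; rewrite capfv dimvf /dim /= mul1n.
suff -> : \dim (limg f) = 1%N by rewrite addn1 => /(congr1 predn).
apply/eqP; rewrite eqn_leq; apply/andP; split.
  by apply: leq_trans (dimvS (subvf _)) _; rewrite dimvf.
rewrite lt0n dimv_eq0; apply: contra c0 => /eqP f0.
have : f c \in limg f by rewrite memv_img ?memvf.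
by rewrite f0 memv0 lfunE /= dotp_eq0.
Qed.

Lemma affine_dim_hyperplane_disk F p c (e : R) :
  c != 0 -> 0 < e -> (forall q, F q -> dotp c q = dotp c p) ->
  (forall q, enorm (q - p) <= e -> dotp c q = dotp c p -> F q) ->
  has_affine_dim F N.-1.
Proof.
move=> c0 e0 Fc diskF; have [U [dimU UE]] := dim_orthogonal c0.
exists p, U; split=> //; apply/seteqP; split => q.
  move=> [n [a [v [Fv a1 ->]]]]; exists (\sum_(i < n) a i *: v i - p).
    rewrite /= UE dotpDr dotpNr dotp_sumr.
    under eq_bigr do rewrite dotpZr Fc //.
    by rewrite -mulr_suml a1 mul1r subrr.
  by rewrite addrC subrK.
move=> [u /= ]; rewrite UE => /eqP cu <-.
(* p and p + t u both lie in the disk, and p + u is on the line through them *)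
pose t := e / (1 + enorm u).
have u0 : 0 < 1 + enorm u by rewrite ltr_pwDl // enorm_ge0.
have t0 : 0 < t by rewrite divr_gt0.
exists 2%N, (fun i => if i == 0 then 1 - t^-1 else t^-1),
  (fun i => if i == 0 then p else p + t *: u); split.
- move=> i; case: ifP => _; apply: diskF => //.
  + by rewrite subrr enorm0 ltW.
  + rewrite addrAC subrr add0r enormZ gtr0_norm // /t mulrAC ler_pdivrMr //.
    by rewrite ler_pM2l // lerDr.
  + by rewrite dotpDr dotpZr cu mulr0 addr0.
- by rewrite !big_ord_recl big_ord0 /= addr0 subrK.
- rewrite !big_ord_recl big_ord0 /= addr0 scalerDr scalerA mulVf ?gt_eqF //.
  by rewrite scale1r addrA -scalerDl subrK scale1r.
Qed.

End HyperplaneDisk.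

Section Bisectors.
Context {R : realType} {N : nat}.
Implicit Types (p q x y : 'rV[R]_N).

(** In [enorm (q - x) <= enorm (q - y)] the square of [q] cancels, which makes
    Voronoi cells intersections of half-spaces. *)
Lemma closer_dotp x y q : (enorm (q - x) <= enorm (q - y)) =
  (dotp (y - x) q <= (dotp y y - dotp x x) / 2).
Proof.
rewrite ler_enorm !dotpE (dotpC q x) (dotpC q y); apply/idP/idP; lra.
Qed.

Lemma equidistant_dotp x y q : enorm (q - x) = enorm (q - y) <->
  dotp (y - x) q = (dotp y y - dotp x x) / 2.
Proof.
split=> h; last first.
  apply/eqP; rewrite eq_le closer_dotp h lexx closer_dotp.
  by move: h; rewrite !dotpE; lra.
apply/eqP; rewrite eq_le -closer_dotp h lexx /=.
have := closer_dotp y x q; rewrite h lexx => /esym; rewrite !dotpE; lra.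
Qed.

End Bisectors.

(** * Delone sets and their Voronoi cells *)

Section FiniteChoice.
Context {R : realType} {T : eqType}.
Implicit Types (s : seq T) (f : T -> R).

Lemma seq_argmin s f : s != [::] ->
  exists2 z, z \in s & forall w, w \in s -> f z <= f w.
Proof.
elim: s => // a s IH _; have [->|/IH[z zs zmin]] := eqVneq s [::].
  by exists a => [|w]; rewrite ?mem_head // mem_seq1 => /eqP ->.
have [az|za] := leP (f a) (f z).
  exists a => [|w]; rewrite ?mem_head // inE => /predU1P[->//|/zmin].
  exact: le_trans.
exists z => [|w]; rewrite inE ?zs ?orbT // => /predU1P[->|/zmin//].
exact: ltW.
Qed.

Lemma seq_gap s f (a : R) : (forall w, w \in s -> a < f w) ->
  exists2 e, 0 < e & forall w, w \in s -> a + e <= f w.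
Proof.
elim: s => [|b s IH] h; first by exists 1.
have [w ws|e e0 he] := IH; first by apply: h; rewrite inE ws orbT.
exists (Num.min e (f b - a)); first by rewrite lt_min e0 subr_gt0 h ?mem_head.
move=> w; rewrite inE => /predU1P[->|/he]; last by rewrite -!lerBrDl ge_min => ->.
by rewrite -lerBrDl ge_min lexx orbT.
Qed.

End FiniteChoice.

Section DeloneSets.
Context {R : realType} {N : nat} {rmin Rmax : R} {L : set 'rV[R]_N}
  (hL : is_delone rmin Rmax L).
Implicit Types (p q x y z : 'rV[R]_N).

Let rmin_gt0 : 0 < rmin. Proof. by case: hL. Qed.
Let Rmax_gt0 : 0 < Rmax. Proof. by case: hL. Qed.

Lemma delone_near p : exists2 z, L z & enorm (p - z) <= Rmax.
Proof.
case: hL => _ _ _ cov.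
have [z Lz [v vR <-]] : (\bigcup_(x in L) [set x + v | v in cball Rmax]) p.
  by rewrite cov.
by exists z; rewrite // addrAC subrr add0r.
Qed.

(** In a grid of mesh [rmin / N.+1], two points in the same cell of the grid are
    at distance less than [2 * rmin], so a point of the set is determined by its
    grid cell, and a ball meets finitely many grid cells. *)
Lemma delone_locally_finite p (S : R) :
  finite_set [set z | L z /\ enorm (z - p) <= S].
Proof.
set A := [set z | _].
pose h := rmin / N.+1%:R.
have h0 : 0 < h by rewrite divr_gt0.
pose cell z (i : 'I_N) := Num.truncn ((z 0 i - p 0 i + S) / h).
pose K := Num.truncn (2 * S / h).
pose G z : {ffun 'I_N -> 'I_K.+1} := [ffun i => inord (cell z i)].
have coordA z i : A z -> 0 <= z 0 i - p 0 i + S <= 2 * S.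
  move=> [_ zS]; have := le_trans (coord_le_enorm (z - p) i) zS.
  by rewrite !mxE ler_norml => /andP[? ?]; apply/andP; split; lra.
suff inj : {in A &, injective G}.
  by rewrite -(eq_finite_set (inj_card_eq inj)); exact: finite_finset.
move=> x y /[!inE] Ax Ay Gxy; apply/eqP/negPn/negP => xy.
case: hL => _ _ sep _; have := sep x y Ax.1 Ay.1 xy; apply/negP; rewrite -ltNge.
apply: (@le_lt_trans _ _ (N%:R * h)); last first.
  rewrite /h mulrCA; apply: (@le_lt_trans _ _ (rmin * 1)).
    by rewrite ler_pM2l // ler_pdivrMr // mul1r ler_nat.
  by rewrite mulr1 ltr_pMl // ltr1n.
apply: enorm_le_coord; first exact: ltW.
move=> i; move/ffunP/(_ i): Gxy; rewrite !ffunE => /(congr1 val) /=.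
have lt_cell z : A z -> (cell z i < K.+1)%N.
  move=> /(coordA z i) /andP[_ z2]; rewrite ltnS; apply: le_truncn.
  by rewrite ler_pM2r ?invr_gt0.
have cell_itv z : A z ->
    (cell z i)%:R * h <= z 0 i - p 0 i + S < (cell z i).+1%:R * h.
  move=> /(coordA z i) /andP[z0 _]; rewrite -ler_pdivlMr // -ltr_pdivrMr //.
  by apply: truncn_itv; rewrite divr_ge0 // ltW.
rewrite !inordK ?lt_cell // => cxy.
have := cell_itv x Ax; have := cell_itv y Ay; rewrite cxy -natr1 mulrDl mul1r.
move=> /andP[y1 y2] /andP[x1 x2].
by rewrite !mxE ler_norml; apply/andP; split; lra.
Qed.

Lemma voronoi_cell_cover p : exists2 z, L z & voronoi_cell L z p.
Proof.
have [z0 Lz0 z0R] := delone_near p.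
have /finite_seqP[s sE] := delone_locally_finite p Rmax.
have mem_s w : (w \in s) <-> L w /\ enorm (w - p) <= Rmax.
  by have -> : (L w /\ enorm (w - p) <= Rmax) = [set` s] w by rewrite -sE.
have z0s : z0 \in s by apply/mem_s; rewrite edistC.
have sn0 : s != [::] by apply: contraTneq z0s => ->.
have [z zs zmin] := seq_argmin (fun w => enorm (p - w)) sn0.
have [Lz zR] := (mem_s z).1 zs; exists z => // w Lw _.
have [wR|wR] := leP (enorm (w - p)) Rmax; first by apply: zmin; apply/mem_s.
by rewrite edistC (le_trans zR) // edistC ltW // edistC.
Qed.

Lemma voronoi_cell_radius z p : voronoi_cell L z p -> enorm (p - z) <= Rmax.
Proof.
move=> zp; have [w Lw wR] := delone_near p.
by have [<-//|wz] := eqVneq w z; exact: le_trans (zp w Lw wz) wR.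
Qed.

Lemma voronoi_cell_center z : voronoi_cell L z z.
Proof. by move=> w _ _; rewrite subrr enorm0 enorm_ge0. Qed.

(** Centers are [2 * rmin] apart, so a point within [rmin] of [z] is at distance
    at least [rmin] from every other center. *)
Lemma voronoi_cell_inball z p : L z -> enorm (p - z) <= rmin ->
  voronoi_cell L z p.
Proof.
move=> Lz zr w Lw wz; case: hL => _ _ sep _; have := sep w z Lw Lz wz.
have := edist_triangle p w z; rewrite (edistC w p); lra.
Qed.

End DeloneSets.

(** * Generic segments *)

Section GenericPoints.
Context {R : realType} {N : nat}.
Implicit Types (a b c x y p : 'rV[R]_N).

Lemma poly_nonroot_near0 (P : {poly R}) (e : R) : P != 0 -> 0 < e ->
  exists2 t, 0 < t <= e & ~~ root P t.
Proof.
move=> P0 e0; pose u k := e / k.+1%:R.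
pose rs := [seq u k | k <- iota 0 (size P)].
have urs : uniq rs.
  rewrite map_inj_in_uniq ?iota_uniq // => i j _ _ /(mulfI _).
  rewrite gt_eqF // => /(_ isT) /invr_inj /eqP.
  by rewrite eqr_nat eqSS => /eqP.
have : ~~ all (root P) rs.
  apply/negP => /(max_poly_roots P0)/(_ urs).
  by rewrite size_map size_iota ltnn.
move=> /allPn[_ /mapP[k _ ->] Pk]; exists (u k) => //.
by rewrite divr_gt0 //= ler_pdivrMr // ler_peMr ?ler1n // ltW.
Qed.

(** A hyperplane meets the moment curve through [y] only in the roots of one
    nonzero polynomial, so a generic short step along the curve avoids finitely
    many hyperplanes at once. *)
Lemma avoid_hyperplanes (s : seq ('rV[R]_N * R)) y (e : R) : 0 < e ->
  (forall cb, cb \in s -> cb.1 != 0) ->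
  exists2 y', enorm (y' - y) <= e & forall cb, cb \in s -> dotp cb.1 y' != cb.2.
Proof.
move=> e0 s0; pose moment (t : R) : 'rV[R]_N := \row_i t ^+ i.+1.
pose P (cb : 'rV[R]_N * R) : {poly R} :=
  (dotp cb.1 y - cb.2)%:P + \sum_(i < N) cb.1 0 i *: 'X^(i.+1).
have PE cb t : (P cb).[t] = dotp cb.1 (y + moment t) - cb.2.
  rewrite /P hornerD hornerC horner_sum dotpDr [RHS]addrAC; congr (_ + _).
  by apply: eq_bigr => i _; rewrite hornerZ hornerXn mxE.
have P0 cb : cb.1 != 0 -> P cb != 0.
  apply: contra => /eqP Pcb; apply/eqP/rowP => i; rewrite mxE.
  have := congr1 (fun q : {poly R} => q`_i.+1) Pcb.
  rewrite coef0 coefD coefC /= add0r coef_sum (bigD1 i) //= big1 ?addr0.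
    by rewrite coefZ coefXn eqxx mulr1.
  move=> j ji; rewrite coefZ coefXn eqSS; case: eqP => [ij|]; last by rewrite mulr0.
  by move: ji; rewrite -val_eqE /= ij eqxx.
pose e' := Num.min 1 (e / N.+1%:R).
have e'0 : 0 < e' by rewrite lt_min ltr01 divr_gt0.
have prod0 : \prod_(cb <- s) P cb != 0.
  by rewrite prodf_seq_neq0; apply/allP => cb /s0 /P0.
have [t /andP[t0 te] rt] := poly_nonroot_near0 prod0 e'0.
exists (y + moment t); last first.
  move=> cb cbs; move: rt; rewrite /root horner_prod prodf_seq_neq0.
  by move=> /allP/(_ cb cbs) /=; rewrite PE subr_eq0.
rewrite addrAC subrr add0r.
move: te; rewrite le_min => /andP[t1 te].
apply: (@le_trans _ _ (N%:R * t)).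
  apply: enorm_le_coord; first exact: ltW.
  have t0' := ltW t0; move=> i; rewrite mxE ger0_norm ?exprn_ge0 // exprS.
  by rewrite ler_piMr ?exprn_ile1.
apply: (@le_trans _ _ (N.+1%:R * t)); first by rewrite ler_pM2r // ler_nat.
by rewrite mulrC -ler_pdivlMr.
Qed.

(** The bisectors of [a], [b] and of [a], [c] belong to a pencil, and one member
    of the pencil contains [x]: this hyperplane contains all lines from [x] to
    the points equidistant from [a], [b], [c].  If the pencil degenerates, then
    [a], [b], [c] lie on a line and no point is equidistant from them. *)
Lemma equidistant_hyperplane x a b c : a != b -> a != c -> b != c ->
  exists cb : 'rV[R]_N * R, cb.1 != 0 /\ forall y (t : R), t != 0 ->
    enorm (x + t *: (y - x) - a) = enorm (x + t *: (y - x) - b) ->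
    enorm (x + t *: (y - x) - a) = enorm (x + t *: (y - x) - c) ->
    dotp cb.1 y = cb.2.
Proof.
move=> ab ac bc.
pose beta := (dotp b b - dotp a a) / 2; pose gamma := (dotp c c - dotp a a) / 2.
pose u := dotp (b - a) x - beta; pose v := dotp (c - a) x - gamma.
have ba : b - a != 0 by rewrite subr_eq0 eq_sym.
have ca : c - a != 0 by rewrite subr_eq0 eq_sym.
have [u0|u0] := eqVneq u 0.
  exists (b - a, beta); split=> //= y t t0 /equidistant_dotp + _.
  rewrite -/beta !(dotpDr, dotpZr, dotpNr) => E.
  have bx : dotp (b - a) x = beta by move/eqP: u0; rewrite subr_eq0 => /eqP.
  apply/eqP; rewrite -subr_eq0 -(mulrI_eq0 _ (mulfI t0)) -{1}bx; apply/eqP.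
  by move: E; rewrite bx; lra.
pose n := u *: (c - a) - v *: (b - a).
have [n0|n0] := eqVneq n 0; last first.
  exists (n, u * gamma - v * beta); split=> //= y t t0.
  move=> /equidistant_dotp + /equidistant_dotp.
  rewrite -/beta -/gamma => Eb Ec.
  have : dotp n (x + t *: (y - x)) = u * gamma - v * beta.
    by rewrite /n dotpDl dotpNl !dotpZl Eb Ec.
  have nx : dotp n x = u * gamma - v * beta.
    by rewrite /n dotpDl dotpNl !dotpZl /u /v; ring.
  rewrite dotpDr dotpZr dotpDr dotpNr nx => /eqP.
  rewrite -subr_eq0 [_ + t * _]addrC addrK mulf_eq0 (negPf t0) /= subr_eq0.
  by move=> /eqP.
exists (b - a, 0); split=> //= y t _ /equidistant_dotp + /equidistant_dotp.
move: (x + _) => p Eb Ec; exfalso.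
pose l := v / u.
have cE : c = a + l *: (b - a).
  have : c - a = l *: (b - a).
    apply: (scalerI u0); rewrite scalerA /l mulrCA divff // mulr1.
    by apply/eqP; rewrite -subr_eq0; apply/eqP.
  by move=> <-; rewrite addrCA subrr addr0.
clearbody l; have : l * (l - 1) * dotp (b - a) (b - a) = 0.
  move: Eb Ec; rewrite cE [a + _]addrC addrK !dotpE !(dotpC b a) => Eb Ec.
  have Ep : dotp b p = (dotp b b - dotp a a) / 2 + dotp a p by lra.
  move: Ec; rewrite Ep => Ec; nra.
move=> /eqP; rewrite !mulf_eq0 dotp_eq0 (negPf ba) orbF subr_eq0.
case/orP => /eqP l0; move: cE; rewrite l0.
  by rewrite scale0r addr0 => ca'; rewrite ca' eqxx in ac.
by rewrite scale1r addrC subrK => cb; rewrite cb eqxx in bc.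
Qed.

End GenericPoints.

(** * Chains of cells along a segment *)

Section Chains.
Context {R : realType}.

(** Let [C] be closed under passing from a member of the cover to one that meets
    it.  The members in [C] and those outside [C] have closed unions, which are
    disjoint and cover the connected interval; the first union contains [0], so
    it is everything. *)
Lemma closed_cover_chain (T : choiceType) (K C : set T) (I : T -> set R) :
  finite_set K -> (forall k, K k -> closed (I k)) ->
  (forall t, 0 <= t <= 1 -> exists2 k, K k & I k t) ->
  (forall a b t, K a -> K b -> 0 <= t <= 1 -> I a t -> I b t -> C a -> C b) ->
  (exists a, [/\ K a, C a & I a 0]) ->
  forall b, K b -> I b 1 -> C b.
Proof.
move=> finK clI cov stepC [a0 [Ka0 Ca0 Ia0]] b Kb Ib1.
pose A := \bigcup_(k in K `&` C) I k; pose B := \bigcup_(k in K `\` C) I k.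
have clA : closed A.
  by apply: closed_bigcup => [|k [/clI]]; first exact: finite_setIl.
have clB : closed B.
  by apply: closed_bigcup => [|k [/clI]]; first exact: finite_setD.
have AB : `[0, 1]%classic `&` A = `[0, 1]%classic `&` ~` B.
  apply/seteqP; split => t [t01]; rewrite /= in_itv /= in t01.
    move=> [a [Ka Ca] Iat]; split=> [|[k [Kk nCk] Ikt]]; first by rewrite /= in_itv.
    exact/nCk/(stepC a k t).
  move=> nBt; split; first by rewrite /= in_itv.
  have [k Kk Ikt] := cov t t01; exists k => //; split=> //.
  by apply: contrapT => nCk; apply: nBt; exists k.
have : (`[0, 1]%classic `&` A) 1.
  have := @segment_connected R 0 1 (`[0, 1]%classic `&` A).
  move=> -> //; first by rewrite /= in_itv /= ler01 lexx.
  - by exists 0; split; [rewrite /= in_itv /= ler01 lexx|exists a0].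
  - by exists (~` B); rewrite // openC.
  - by exists A.
by move=> [_ [a [Ka Ca] Ia1]]; apply: (stepC a b 1) => //; rewrite ler01 lexx.
Qed.

Lemma closed_affine_le (al be b : R) : closed [set t : R | al + t * be <= b].
Proof.
apply: (@closed_comp _ _ (fun t : R => al + t * be) [set u | u <= b]).
  move=> t _; apply: cvgD; first exact: cvg_cst.
  by apply: cvgM; [exact: cvg_id|exact: cvg_cst].
exact: closed_le.
Qed.

End Chains.

Section VoronoiFacets.
Context {R : realType} {N : nat} {rmin Rmax : R} {L : set 'rV[R]_N}
  (hL : is_delone rmin Rmax L).
Implicit Types (p q x y z w : 'rV[R]_N).

Lemma closed_voronoi_line z x d :
  closed [set t : R | voronoi_cell L z (x + t *: d)].
Proof.
rewrite (_ : [set t | _] = \bigcap_(w in [set w | L w /\ w != z])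
  [set t | dotp (w - z) x + t * dotp (w - z) d <=
           (dotp w w - dotp z z) / 2]).
  by apply: closed_bigI => w _; exact: closed_affine_le.
apply/seteqP; split => t /= H w.
  by move=> [Lw wz]; have := H w Lw wz; rewrite closer_dotp dotpDr dotpZr.
by move=> Lw wz; have := H w (conj Lw wz); rewrite closer_dotp dotpDr dotpZr.
Qed.

(** The bisector supports the cell of [z]; a small disk of the bisector inside the
    cell makes this face one of full dimension. *)
Lemma voronoi_facet z w p (e : R) : L w -> z != w -> 0 < e ->
  enorm (p - z) = enorm (p - w) ->
  (forall q, enorm (q - p) <= e -> enorm (q - z) = enorm (q - w) ->
     voronoi_cell L z q) ->
  is_face_of_dim N.-1 (voronoi_cell L z)
    (voronoi_cell L z `&` [set q | enorm (q - z) = enorm (q - w)]).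
Proof.
move=> Lw zw e0 pzw diskz.
have wz : w != z by rewrite eq_sym.
split.
  exists (w - z), ((dotp w w - dotp z z) / 2); split.
    by move=> q zq; rewrite -closer_dotp; exact: zq.
  by congr (_ `&` _); apply/seteqP; split => q /equidistant_dotp.
have bis q : dotp (w - z) q = dotp (w - z) p <-> enorm (q - z) = enorm (q - w).
  by rewrite equidistant_dotp (equidistant_dotp z w p).1.
apply: (@affine_dim_hyperplane_disk _ _ _ p (w - z) e) => //.
- by rewrite subr_eq0.
- by move=> q [_ /bis].
- by move=> q qe /bis qzw; split=> //; exact: diskz.
Qed.

(** Local finiteness leaves a gap between the two nearest points of [p] and all
    the others, so the part of the bisector near [p] stays in both cells. *)
Lemma voronoi_share_facet z w p : L z -> L w -> z != w ->
  voronoi_cell L z p -> voronoi_cell L w p ->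
  (forall v, L v -> voronoi_cell L v p -> v = z \/ v = w) ->
  share_facet_part (voronoi_cell L z) (voronoi_cell L w).
Proof.
move=> Lz Lw zw zp wp only.
have wz : w != z by rewrite eq_sym.
have pzw : enorm (p - z) = enorm (p - w).
  by apply/eqP; rewrite eq_le zp // wp.
pose rho := enorm (p - z).
have /finite_seqP[s sE] := delone_locally_finite hL p (rho + 1).
have mem_s v : (v \in s) <-> L v /\ enorm (v - p) <= rho + 1.
  by have -> : (L v /\ enorm (v - p) <= rho + 1) = [set` s] v by rewrite -sE.
have [v|e0 e00 he0] :=
  @seq_gap R _ [seq v <- s | (v != z) && (v != w)] (fun v => enorm (p - v)) rho.
  rewrite mem_filter => /andP[/andP[vz vw] /mem_s[Lv _]].
  rewrite ltNge; apply/negP => pv.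
  have vp : voronoi_cell L v p.
    move=> u Lu uv; apply: le_trans pv _.
    by have [->//|uz] := eqVneq u z; exact: zp.
  by case: (only v Lv vp) vz vw => ->; rewrite eqxx.
(* moving p by at most e, half of the gap, changes both distances by at most e *)
pose e := Num.min e0 1 / 2.
have e_gt0 : 0 < e by rewrite divr_gt0 // lt_min e00 ltr01.
have gap v : L v -> v != z -> v != w -> rho + 2 * e <= enorm (p - v).
  move=> Lv vz vw; rewrite [2 * e]mulrC divfK ?pnatr_eq0 //.
  have [vs|vs] := leP (enorm (v - p)) (rho + 1).
    apply: le_trans (he0 v _); last by rewrite mem_filter vz vw; apply/mem_s.
    by rewrite lerD2l ge_min lexx.
  rewrite edistC; apply: le_trans (ltW vs).
  by rewrite lerD2l ge_min lexx orbT.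
have near q : enorm (q - p) <= e -> enorm (q - z) = enorm (q - w) ->
    voronoi_cell L z q /\ voronoi_cell L w q.
  move=> qp qzw.
  have far v : L v -> v != z -> v != w -> enorm (q - z) <= enorm (q - v).
    move=> Lv vz vw; have := gap v Lv vz vw.
    have := edist_triangle q p v; have := edist_triangle p q z.
    rewrite (edistC p q) -/rho; lra.
  split=> v Lv vn.
    by have [->|vw] := eqVneq v w; [rewrite qzw|exact: far].
  by rewrite -qzw; have [->//|vz] := eqVneq v z; exact: far.
exists (voronoi_cell L z `&` [set q | enorm (q - z) = enorm (q - w)]),
       (voronoi_cell L w `&` [set q | enorm (q - w) = enorm (q - z)]); split.
- by apply: (@voronoi_facet z w p e) => // q qe qzw; case: (near q qe qzw).
- by apply: (@voronoi_facet w z p e) => // q qe /esym qzw; case: (near q qe qzw).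
apply: (@hausdorff_codim1_disk_gt0 _ _ _ p (w - z) e) => //.
  by rewrite subr_eq0.
move=> q qe; rewrite ((equidistant_dotp z w p).1 pzw) => /equidistant_dotp qzw.
by have [? ?] := near q qe qzw.
Qed.

End VoronoiFacets.

(** * Neighbor relations *)

Section NeighborRelations.
Context {R : realType} {N : nat} {rmin Rmax : R} {L : set 'rV[R]_N}
  (hL : is_delone rmin Rmax L).
Implicit Types (p q x y z w : 'rV[R]_N) (E : set ('rV[R]_N * 'rV[R]_N)).

Let rmin_gt0 : 0 < rmin. Proof. by case: hL. Qed.
Let Rmax_gt0 : 0 < Rmax. Proof. by case: hL. Qed.

(** Local finiteness leaves finitely many triples, and [t != 0] leaves out the
    point [x], which lies on all the segments. *)
Lemma generic_endpoint x y (M : R) : exists2 y', enorm (y' - y) <= rmin &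
  forall a b c (t : R), L a -> L b -> L c ->
    enorm (a - x) <= M -> enorm (b - x) <= M -> enorm (c - x) <= M ->
    a != b -> a != c -> b != c -> t != 0 ->
    enorm (x + t *: (y' - x) - a) = enorm (x + t *: (y' - x) - b) ->
    enorm (x + t *: (y' - x) - a) <> enorm (x + t *: (y' - x) - c).
Proof.
pose K := [set z | L z /\ enorm (z - x) <= M].
have finK : finite_set K by exact: (delone_locally_finite hL).
have /finite_seqP[s sE] := finite_setX (finite_setX finK finK) finK.
have mem_s a b c : K a -> K b -> K c -> (a, b, c) \in s.
  by move=> Ka Kb Kc; have : [set` s] (a, b, c) by rewrite -sE.
have H (abc : 'rV[R]_N * 'rV[R]_N * 'rV[R]_N) : exists cb : 'rV[R]_N * R,
    let: (a, b, c) := abc in a != b -> a != c -> b != c ->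
    cb.1 != 0 /\ forall y (t : R), t != 0 ->
    enorm (x + t *: (y - x) - a) = enorm (x + t *: (y - x) - b) ->
    enorm (x + t *: (y - x) - a) = enorm (x + t *: (y - x) - c) ->
    dotp cb.1 y = cb.2.
  case: abc => [[a b] c].
  have [abc|nabc] := pselect [/\ a != b, a != c & b != c].
    case: abc => ab ac bc.
    by have [cb ?] := equidistant_hyperplane x ab ac bc; exists cb.
  by exists (0, 0) => ab ac bc; case: nabc.
have [f fP] := choice H.
pose S := [seq f abc | abc <- s &
  [&& abc.1.1 != abc.1.2, abc.1.1 != abc.2 & abc.1.2 != abc.2]].
have [||y' y'y Hy'] := @avoid_hyperplanes R N S y rmin => //.
  move=> cb /mapP[[[a b] c]]; rewrite mem_filter /= => /andP[/and3P[ab ac bc] _ ->].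
  by have [] := fP (a, b, c) ab ac bc.
exists y' => // a b c t La Lb Lc aM bM cM ab ac bc t0 eab eac.
have [_ /(_ y' t t0 eab eac) /eqP] := fP (a, b, c) ab ac bc.
apply/negP/Hy'/map_f; rewrite mem_filter /= ab ac bc /=.
by apply: mem_s.
Qed.

(** Connectedness of the facet graph near the segment, as an induction principle:
    [C] stands for reachability from [x] by chains of any kind.  A cell that meets
    the segment from [x] to the generic endpoint has its center within [Rmax] of
    that segment, which is itself within [rmin] of the segment from [x] to [y]. *)
Lemma voronoi_connected_along x y (C : set 'rV[R]_N) : L x -> L y -> C x ->
  (forall a b, L a -> L b ->
     share_facet_part (voronoi_cell L a) (voronoi_cell L b) ->
     setsum (segment x y) (cball (Rmax + rmin)) b -> C a -> C b) ->
  C y.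
Proof.
move=> Lx Ly Cx stepC.
(* M bounds the distance from x to the centers of all cells that the perturbed
   segment can meet *)
pose M := Rmax + (rmin + enorm (y - x)).
have [y' y'y gen] := generic_endpoint x y M.
pose path (t : R) := x + t *: (y' - x).
pose K := [set z | L z /\ enorm (z - x) <= M].
have y'x : enorm (y' - x) <= rmin + enorm (y - x).
  by apply: le_trans (edist_triangle y _ _) _; rewrite lerD2r.
have inK z t : L z -> 0 <= t <= 1 -> voronoi_cell L z (path t) -> K z.
  move=> Lz /andP[t0 t1] /(voronoi_cell_radius hL) zR; split=> //.
  apply: le_trans (edist_triangle (path t) _ _) _; rewrite edistC lerD //.
  rewrite /path addrAC subrr add0r enormZ ger0_norm //.
  by apply: le_trans y'x; rewrite ler_piMl // enorm_ge0.
have near z t : 0 <= t <= 1 -> voronoi_cell L z (path t) ->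
    setsum (segment x y) (cball (Rmax + rmin)) z.
  move=> t01 /(voronoi_cell_radius hL) zR; have /andP[t0 t1] := t01.
  exists (x + t *: (y - x)); first by exists t.
  exists (z - (x + t *: (y - x))); last by rewrite addrC subrK.
  apply: le_trans (edist_triangle (path t) _ _) _; rewrite edistC lerD //.
  rewrite (_ : _ - _ = t *: (y' - y)); last first.
    by apply/rowP => i; rewrite !mxE; ring.
  rewrite enormZ ger0_norm //; apply: le_trans y'y.
  by rewrite ler_piMl // enorm_ge0.
apply: (@closed_cover_chain R _ K C (fun z => [set t | voronoi_cell L z (path t)])).
- exact: (delone_locally_finite hL).
- by move=> z _; exact: closed_voronoi_line.
- move=> t t01; have [z Lz zt] := voronoi_cell_cover hL (path t).
  by exists z => //; exact: inK zt.
- move=> a b t [La aM] [Lb bM] t01 /= at_ bt Ca.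
  have [<-//|ab] := eqVneq a b.
  apply: (stepC a b) => //; last exact: near bt.
  apply: (voronoi_share_facet hL La Lb ab at_ bt) => v Lv vt.
  have [va|va] := eqVneq v a; first by left.
  have [vb|vb] := eqVneq v b; first by right.
  have eqd u w : L u -> L w -> u != w -> voronoi_cell L u (path t) ->
      voronoi_cell L w (path t) -> enorm (path t - u) = enorm (path t - w).
    by move=> Lu Lw uw ut wt; apply/eqP; rewrite eq_le ut // ?wt // eq_sym.
  have [t0|t0] := eqVneq t 0.
    (* the segment starts at x, which is its own only nearest point *)
    have px u : L u -> voronoi_cell L u (path t) -> u = x.
      move=> Lu ut; have [//|ux] := eqVneq u x.
      have := eqd u x Lu Lx ux ut; rewrite /path t0 scale0r addr0 subrr enorm0.
      move=> /(_ (@voronoi_cell_center _ _ L x)) /enorm_eq0 /eqP.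
      by rewrite subr_eq0 => /eqP ->.
    by move: ab; rewrite (px a) // (px b) // eqxx.
  have [_ vM] := inK v t Lv t01 vt.
  have av : a != v by rewrite eq_sym.
  have bv : b != v by rewrite eq_sym.
  by case: (gen a b v t) => //; exact: eqd.
- exists x; split=> //=; last first.
    by rewrite /path scale0r addr0; exact: (@voronoi_cell_center _ _ L x).
  by split=> //; rewrite subrr enorm0 !addr_ge0 ?enorm_ge0 // ltW.
- split=> //; rewrite /M; have := rmin_gt0; have := Rmax_gt0; lra.
- rewrite /= /path scale1r addrC subrK.
  exact: (voronoi_cell_inball hL).
Qed.

Lemma neighbor_path x y : L x -> L y -> forall E,
  (forall a b, L a -> L b ->
     share_facet_part (voronoi_cell L a) (voronoi_cell L b) -> E (a, b)) ->
  exists (n : nat) (z : nat -> 'rV[R]_N),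
    [/\ z 0%N = x, z n = y, forall i, (i <= n)%N -> L (z i),
        forall i, (i < n)%N -> E (z i, z i.+1)
      & forall i, (i <= n)%N ->
          setsum (segment x y) (cball (Rmax + rmin)) (z i)].
Proof.
move=> Lx Ly E shareE.
pose C : set 'rV[R]_N := [set y' | exists (n : nat) (z : nat -> 'rV[R]_N),
  [/\ z 0%N = x, z n = y', forall i, (i <= n)%N -> L (z i),
      forall i, (i < n)%N -> E (z i, z i.+1)
    & forall i, (i <= n)%N ->
        setsum (segment x y) (cball (Rmax + rmin)) (z i)]].
suff : C y by [].
apply: (voronoi_connected_along Lx Ly).
  exists 0%N, (fun=> x); split=> // i _.
  exists x; first by exists 0; [rewrite /= lexx ler01|rewrite scale0r addr0].
  by exists 0; rewrite ?addr0 // /cball /= enorm0 addr_ge0 ?ltW.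
move=> a b La Lb ab nearb [n [z [z0 zn zL zE znear]]].
exists n.+1, (fun i => if (i <= n)%N then z i else b); split=> //.
- by rewrite ltnn.
- by move=> i _; case: ifP => [/zL|].
- move=> i; rewrite ltnS => i_n; rewrite i_n; case: ltnP => [/zE//|n_i].
  have -> : i = n by apply/eqP; rewrite eqn_leq i_n.
  by rewrite zn; exact: shareE.
- by move=> i _; case: ifP => [/znear|].
Qed.

Lemma share_facet_part_sym (A B : set 'rV[R]_N) :
  share_facet_part A B -> share_facet_part B A.
Proof. by move=> [F [F' [? ? ?]]]; exists F', F; split=> //; rewrite setIC. Qed.

Lemma voronoi_sub_max : voronoi_neighbors L `<=` max_neighbors Rmax L.
Proof.
move=> [x y] [/= Lx Ly [F [F' [[[c [b [_ FE]]] _] [[c' [b' [_ FE']]] _] Fpos]]]].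
split=> //=.
have [FF0|/set0P[p [Fp F'p]]] := eqVneq (F `&` F') set0.
  by move: Fpos; rewrite FF0 ltNge hausdorff_set0.
have xp : voronoi_cell L x p by move: Fp; rewrite FE => -[].
have yp : voronoi_cell L y p by move: F'p; rewrite FE' => -[].
have := voronoi_cell_radius hL xp; have := voronoi_cell_radius hL yp.
have := edist_triangle p x y; rewrite (edistC x p); lra.
Qed.

Lemma delone_other_point x : (0 < N)%N -> exists2 y, L y & y != x.
Proof.
move=> hN; pose u : 'rV[R]_N := const_mx (2 * Rmax).
have [y Ly yR] := delone_near hL (x + u).
exists y => //; apply/eqP => yx.
move: yR; rewrite yx addrAC subrr add0r => uR.
have := le_trans (coord_le_enorm u (Ordinal hN)) uR.
rewrite mxE gtr0_norm ?mulr_gt0 //; have := Rmax_gt0; lra.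
Qed.

(** A path to another point leaves [x] through some facet of its cell, and that
    facet meets itself in positive measure. *)
Lemma share_facet_part_refl x : (0 < N)%N -> L x ->
  share_facet_part (voronoi_cell L x) (voronoi_cell L x).
Proof.
move=> hN Lx; have [y Ly yx] := delone_other_point x hN.
apply: contrapT => nxx.
have : y = x; last by apply/eqP.
suff : [set z | z = x] y by [].
apply: (voronoi_connected_along Lx Ly) => // a b _ _ ab _ /= ax.
apply: contrapT => _; apply: nxx.
case: ab => F [F' [xF _ Fpos]]; rewrite ax in xF.
exists F, F; split=> //; rewrite setIid.
by apply: lt_le_trans Fpos _; apply: le_hausdorff; exact: subIsetl.
Qed.

End NeighborRelations.

Theorem theorem4 (R : realType) (N : nat) (hN : (0 < N)%N)
    (rmin Rmax : R) (L : set 'rV[R]_N) (hL : is_delone rmin Rmax L) :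
  is_neighbor_relation L (voronoi_neighbors L) /\
  is_neighbor_relation L (max_neighbors Rmax L).
Proof.
have [rmin_gt0 Rmax_gt0 _ _] := hL.
have le2 (x y : 'rV[R]_N) : enorm (x - y) <= 2 * Rmax ->
    enorm (x - y) <= 2 * Rmax + rmin.
  by move=> h; rewrite (le_trans h) // lerDl ltW.
have widen (x y z : 'rV[R]_N) : setsum (segment x y) (cball (Rmax + rmin)) z ->
    setsum (segment x y) (cball (2 * Rmax + rmin)) z.
  move=> [a ? [b bR <-]]; exists a => //; exists b => //.
  by apply: le_trans bR _; lra.
have paths E :
    (forall a b, L a -> L b ->
       share_facet_part (voronoi_cell L a) (voronoi_cell L b) -> E (a, b)) ->
    forall x y, L x -> L y -> exists (n : nat) (z : nat -> 'rV[R]_N),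
      [/\ z 0%N = x, z n = y, forall i, (i <= n)%N -> L (z i),
          forall i, (i < n)%N -> E (z i, z i.+1)
        & forall i, (i <= n)%N ->
            setsum (segment x y) (cball (2 * Rmax + rmin)) (z i)].
  move=> shareE x y Lx Ly.
  have [n [z [? ? ? ? zS]]] := neighbor_path hL Lx Ly shareE.
  by exists n, z; split=> // i /zS /widen.
split; split.
- by move=> [x y] [].
- exists (2 * Rmax + rmin); split; first by rewrite addr_gt0 // mulr_gt0.
  + split=> [x y [/= Lx Ly xy]|x Lx]; split=> //=.
      exact: share_facet_part_sym.
    exact: (share_facet_part_refl hL).
  + by move=> x y /(voronoi_sub_max hL) [_ _ /= /le2].
  + exact: paths.
- by move=> [x y] [].
exists (2 * Rmax + rmin); split; first by rewrite addr_gt0 // mulr_gt0.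
- split=> [x y [/= Lx Ly xy]|x Lx]; split=> //=; first by rewrite edistC.
  by rewrite subrr enorm0 mulr_ge0 // ltW.
- by move=> x y [_ _ /= /le2].
- by apply: paths => a b La Lb ab; apply: (voronoi_sub_max hL).
Qed.
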